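(* Let $\mathbb{K}$ be an algebraically closed field of characteristic zero and $n\ge 2$. Let $L=W_n^{[-1]}\oplus W_n^{[0]}$ be the subalgebra of $W_n=W_n(\mathbb{K})$ consisting of all derivations $\sum_{i=1}^n f_i\frac{\partial}{\partial x_i}$ with $\deg f_i\le 1$ for $i=1,\dots,n$. Let $D=D_{-1}+D_0+D_1+\cdots+D_k\in W_n$ with $D_i\in W_n^{[i]}$, $k\ge 1$ and $D_k\ne 0$. Then $D$ generates together with $L$ the entire Lie algebra $W_n$ (that is, the smallest Lie subalgebra of $W_n$ containing $L$ and $D$ is $W_n$) if and only if $\operatorname{div}D$ is not a constant (i.e. $\operatorname{div} D\notin\mathbb{K}$) and either $k\ge 2$, or $k=1$ and $D_1$ is not proportional to the Euler derivation $E_n$.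
   Context: $W_n=W_n(\mathbb{K})$ is the Lie algebra, under the commutator, of all $\mathbb{K}$-derivations of the polynomial ring $A=\mathbb{K}[x_1,\dots,x_n]$; each element is uniquely $D=\sum_{i=1}^n f_i\frac{\partial}{\partial x_i}$ with $f_i\in A$. For $j\ge -1$, $W_n^{[j]}$ is the $\mathbb{K}$-subspace of all $D=\sum_i f_i\frac{\partial}{\partial x_i}$ in which each $f_i$ is either zero or a homogeneous polynomial of degree $j+1$; $W_n=\bigoplus_{j\ge -1}W_n^{[j]}$. The divergence of $D=\sum_i f_i\frac{\partial}{\partial x_i}$ is $\operatorname{div}D=\sum_i\frac{\partial f_i}{\partial x_i}$. The Euler derivation is $E_n=\sum_{i=1}^n x_i\frac{\partial}{\partial x_i}$. A derivation is called proportional to $E_n$ if it equals $fE_n$ for some polynomial $f\in\mathbb{K}[x_1,\dots,x_n]$. *)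

(* Defs.v *)
From Stdlib Require Import FunctionalExtensionality ProofIrrelevance.
From HB Require Import structures.
From mathcomp Require Import all_boot all_order all_algebra.
From mathcomp Require Import mpoly ring.

Set Implicit Arguments.
Unset Strict Implicit.
Unset Printing Implicit Defensive.

Import GRing.Theory.
Local Open Scope ring_scope.

(* The carrier of W_n(K). *)
Record Der (K : fieldType) (n : nat) := MkDer {
  der_fun :> {mpoly K[n]} -> {mpoly K[n]};
  der_linear : linear der_fun;
  der_leibniz : forall p q, der_fun (p * q) = der_fun p * q + p * der_fun q
}.

Section Derivations.
Variables (K : fieldType) (n : nat).
Local Notation A := {mpoly K[n]}.
Implicit Types (D E : Der K n) (f : 'I_n -> A) (p q : A).

Lemma der_ext D E : D =1 E -> D = E.
Proof.
case: D E => [D lD mD] [E lE mE] /= /functional_extensionality eDE; subst E.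
by rewrite (proof_irrelevance _ lD lE) (proof_irrelevance _ mD mE).
Qed.

Fact derD D p q : D (p + q) = D p + D q.
Proof. by rewrite -{1}[p]scale1r der_linear scale1r. Qed.

Fact der0 D : D 0 = 0.
Proof. by apply: (addrI (D 0)); rewrite -derD !addr0. Qed.

Fact derZ D c p : D (c *: p) = c *: D p.
Proof. by rewrite -[c *: p]addr0 der_linear der0 addr0. Qed.

Fact derN D p : D (- p) = - D p.
Proof. by rewrite -scaleN1r derZ scaleN1r. Qed.

Fact der1 D : D 1 = 0.
Proof.
have := der_leibniz D 1 1; rewrite !mulr1 mul1r => h.
by apply: (addrI (D 1)); rewrite -h addr0.
Qed.

(* The derivation \sum_i f_i d/dx_i. *)
Definition vfield_fun f p : A := \sum_(i < n) f i * p^`M(i).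

Fact vfield_linear f : linear (vfield_fun f).
Proof.
move=> c p q; rewrite /vfield_fun scaler_sumr -big_split /=.
by apply: eq_bigr => i _; rewrite mderivD mderivZ mulrDr scalerAr.
Qed.

Fact vfield_leibniz f p q :
  vfield_fun f (p * q) = vfield_fun f p * q + p * vfield_fun f q.
Proof.
rewrite /vfield_fun mulr_suml mulr_sumr -big_split /=.
by apply: eq_bigr => i _; rewrite mderivM mulrDr !mulrA [f i * p]mulrC.
Qed.

Definition vfield f : Der K n := MkDer (vfield_linear f) (vfield_leibniz f).

(* f_i = D(x_i) in D = \sum_i f_i d/dx_i; see [coef_vfield] and [vfield_coef]. *)
Definition coef D (i : 'I_n) : A := D 'X_i.

Lemma coef_vfield f i : coef (vfield f) i = f i.
Proof.
rewrite /coef /= /vfield_fun (bigD1 i) //= big1 ?addr0 => [|j ji].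
  have -> : 'X_i^`M(i) = 1 :> A; last by rewrite mulr1.
  rewrite mderivX mnm1E eqxx scale1r -mpolyX0; congr 'X_[_].
  by apply/mnmP => j; rewrite mnmBE subnn mnm0E.
by rewrite mderivX mnm1E eq_sym (negPf ji) scale0r mulr0.
Qed.

Lemma der_eq D E : coef D =1 coef E -> D = E.
Proof.
move=> eDE; apply: der_ext.
have eM p q : D p = E p -> D q = E q -> D (p * q) = E (p * q).
  by move=> ep eq; rewrite !der_leibniz ep eq.
have eX (m : 'X_{1..n}) : D 'X_[m] = E 'X_[m].
  rewrite mpolyXE_id; elim/big_ind: _ => [|p q|i _]; [by rewrite !der1|exact: eM|].
  by elim: (m i) => [|k IHk]; rewrite ?expr0 ?der1 // exprS; apply: eM IHk; apply: eDE.
by elim/mpolyind => [|c m p _ _ IH]; rewrite ?der0 // !der_linear eX IH.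
Qed.

Lemma vfield_coef D : vfield (coef D) = D.
Proof. by apply: der_eq => i; rewrite coef_vfield. Qed.

Fact vfield_ffunK :
  cancel (fun D => [ffun i => coef D i]) (fun f : {ffun 'I_n -> A} => vfield f).
Proof. by move=> D; apply: der_eq => i; rewrite coef_vfield ffunE. Qed.

HB.instance Definition _ := Choice.copy (Der K n) (can_type vfield_ffunK).

Fact zero_linear : linear (fun _ : A => 0 : A).
Proof. by move=> c p q; rewrite scaler0 addr0. Qed.
Fact zero_leibniz p q : 0 = 0 * q + p * 0 :> A.
Proof. by rewrite mul0r mulr0 addr0. Qed.
Definition der_zero : Der K n := MkDer zero_linear zero_leibniz.

Fact opp_linear D : linear (fun p => - D p).
Proof. by move=> c p q; rewrite der_linear opprD scalerN. Qed.
Fact opp_leibniz D p q : - D (p * q) = - D p * q + p * - D q.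
Proof. by rewrite der_leibniz opprD mulNr mulrN. Qed.
Definition der_opp D : Der K n := MkDer (opp_linear D) (opp_leibniz D).

Fact add_linear D E : linear (fun p => D p + E p).
Proof. by move=> c p q; rewrite !der_linear scalerDr addrACA. Qed.
Fact add_leibniz D E p q :
  D (p * q) + E (p * q) = (D p + E p) * q + p * (D q + E q).
Proof. by rewrite !der_leibniz mulrDl mulrDr addrACA. Qed.
Definition der_add D E : Der K n := MkDer (add_linear D E) (add_leibniz D E).

Fact scale_linear (a : K) D : linear (fun p => a *: D p).
Proof. by move=> c p q; rewrite der_linear scalerDr !scalerA mulrC. Qed.
Fact scale_leibniz (a : K) D p q :
  a *: D (p * q) = (a *: D p) * q + p * (a *: D q).
Proof. by rewrite der_leibniz scalerDr scalerAl scalerAr. Qed.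
Definition der_scale (a : K) D : Der K n :=
  MkDer (scale_linear a D) (scale_leibniz a D).

Fact der_addA : associative der_add.
Proof. by move=> D E F; apply: der_ext => p /=; rewrite addrA. Qed.
Fact der_addC : commutative der_add.
Proof. by move=> D E; apply: der_ext => p /=; rewrite addrC. Qed.
Fact der_add0 : left_id der_zero der_add.
Proof. by move=> D; apply: der_ext => p /=; rewrite add0r. Qed.
Fact der_addN : left_inverse der_zero der_opp der_add.
Proof. by move=> D; apply: der_ext => p /=; rewrite addNr. Qed.

HB.instance Definition _ :=
  GRing.isZmodule.Build (Der K n) der_addA der_addC der_add0 der_addN.

Fact der_scaleA a b D : der_scale a (der_scale b D) = der_scale (a * b) D.
Proof. by apply: der_ext => p /=; rewrite scalerA. Qed.
Fact der_scale1 : left_id 1 der_scale.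
Proof. by move=> D; apply: der_ext => p /=; rewrite scale1r. Qed.
Fact der_scaleDr : right_distributive der_scale +%R.
Proof. by move=> a D E; apply: der_ext => p /=; rewrite scalerDr. Qed.
Fact der_scaleDl D : {morph der_scale^~ D : a b / a + b}.
Proof. by move=> a b; apply: der_ext => p /=; rewrite scalerDl. Qed.

HB.instance Definition _ :=
  GRing.Zmodule_isLmodule.Build K (Der K n)
    der_scaleA der_scale1 der_scaleDr der_scaleDl.

Fact bracket_linear D E : linear (fun p => D (E p) - E (D p)).
Proof.
by move=> c p q; rewrite !der_linear scalerBr opprD addrACA.
Qed.
Fact bracket_leibniz D E p q :
  D (E (p * q)) - E (D (p * q)) =
  (D (E p) - E (D p)) * q + p * (D (E q) - E (D q)).
Proof.
rewrite !der_leibniz !derD !der_leibniz; ring.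
Qed.
(* The commutator [D, E] = D o E - E o D. *)
Definition bracket D E : Der K n :=
  MkDer (bracket_linear D E) (bracket_leibniz D E).

Record lie_subalgebra (S : Der K n -> Prop) : Prop := {
  lie_zero : S 0;
  lie_add : forall D E, S D -> S E -> S (D + E);
  lie_scale : forall (a : K) D, S D -> S (a *: D);
  lie_bracket : forall D E, S D -> S E -> S (bracket D E)
}.

(* The smallest Lie subalgebra containing X. *)
Definition lie_generated (X : Der K n -> Prop) (E : Der K n) : Prop :=
  forall S, lie_subalgebra S -> (forall D, X D -> S D) -> S E.

Lemma lie_generated_subalgebra X : lie_subalgebra (lie_generated X).
Proof.
split=> [S [] //|D E hD hE S sS XS|a D hD S sS XS|D E hD hE S sS XS].
- by apply: (lie_add sS); [apply: hD|apply: hE].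
- by apply: (lie_scale sS); apply: hD.
- by apply: (lie_bracket sS); [apply: hD|apply: hE].
Qed.

Lemma lie_generated_sub X D : X D -> lie_generated X D.
Proof. by move=> XD S _; apply. Qed.

(* The graded piece W_n^{[m-1]}; the index is shifted so that it is the common
   degree m >= 0 of the coefficients.  The zero polynomial is d.-homog for
   every d. *)
Definition W_homog (m : nat) D : Prop := forall i, coef D i \is m.-homog.

(* W_n^{[-1]} + W_n^{[0]}: msize is the degree plus one (and 0 at 0). *)
Definition W_affine D : Prop := forall i, (msize (coef D i) <= 2)%N.

Definition divergence D : A := \sum_(i < n) (coef D i)^`M(i).

Definition euler : Der K n := vfield (fun i => 'X_i).

Definition proportional_to_euler D : Prop :=
  exists f : A, forall p, D p = f * euler p.

End Derivations.

(* Main.v *)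
Require Import Defs.
From mathcomp Require Import all_boot all_order all_algebra.
From mathcomp Require Import mpoly ring.

Set Implicit Arguments.
Unset Strict Implicit.
Unset Printing Implicit Defensive.

Import GRing.Theory.
Local Open Scope ring_scope.

(** Necessity: two proper Lie subalgebras contain all affine fields.  The
    fields of constant divergence form one, because
    div [D, E] = D (div E) - E (div D).  The projective fields
    C + L + g E_n (C constant, L linear, g a linear form, E_n the Euler field)
    form another: it is the copy of sl_(n+1) acting on the affine chart of
    projective space.  If div D is constant, or if k = 1 and D_1 = g E_n, then
    D lies in one of them, and x_0^2 d_0, respectively x_0^2 d_1, does not.

    Sufficiency: let S be a Lie subalgebra that contains the affine fields and
    D.  Instead of decomposing the gl_n-modules of homogeneous fields, the
    argument works with explicit weight vectors.
    - Since S is stable under the brackets with all x_i d_i, it contains the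
      weight components of D.  These are the multiples of x^m d_j with
      m_j = 0 ([S_weight_monomial]) and the fields x^w (sum_j c_j x_j d_j)
      ([S_weight_wdiag]).
    - If k >= 2, or if k = 1 and D_1 is not a multiple of E_n, one of the
      weight components of D_k has the first form, or the second form with
      nonconstant c, or is c x^w E_n with |w| >= 2.  Brackets with x_a d_b and
      d_i lead from each of them to some x_a^2 d_b with a <> b
      ([square_of_quadratic], [square_of_high_degree]).
    - The affine fields move x_a^2 d_b to all quadratic fields of divergence
      zero ([S_square], [S_cross], [S_trace_free]).
    - As div D is not constant, some x^w (sum_j c_j x_j d_j) with w <> 0 has
      nonzero divergence.  Applying partial derivatives keeps the divergence
      nonzero and makes w of degree 1; modulo the quadratic fields of
      divergence zero the result is a multiple of x_a^2 d_a ([S_self0]).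
      Hence S contains all quadratic fields ([S_quad]).
    - Brackets with quadratic fields raise the degree from d to d + 1 for every
      d >= 2 ([fullS]), so S is everything ([S_all]). *)

(** * Derivations in coordinates *)

Section Fields.
Variables (K : fieldType) (n : nat).
Local Notation A := {mpoly K[n]}.
Implicit Types (D E : Der K n) (p q : A) (i j a b : 'I_n).

Lemma addmAC : right_commutative (@mnm_add n).
Proof. by move=> m1 m2 m3; rewrite -!addmA [(m2 + m3)%MM]addmC. Qed.

Lemma der_coefD D E i : coef (D + E) i = coef D i + coef E i.
Proof. by []. Qed.

Lemma der_coefN D i : coef (- D) i = - coef D i.
Proof. by []. Qed.

Lemma der_coef0 i : coef (0 : Der K n) i = 0.
Proof. by []. Qed.

Lemma der_coefZ c D i : coef (c *: D) i = c *: coef D i.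
Proof. by []. Qed.

Lemma der_coef_sum (I : Type) (r : seq I) (P : pred I) (F : I -> Der K n) i :
  coef (\sum_(t <- r | P t) F t) i = \sum_(t <- r | P t) coef (F t) i.
Proof. by apply: (big_morph (fun D => coef D i)). Qed.

Lemma coef_bracket D E i : coef (bracket D E) i = D (coef E i) - E (coef D i).
Proof. by []. Qed.

Lemma bracketDr F D E : bracket F (D + E) = bracket F D + bracket F E.
Proof. by apply: der_ext => p /=; rewrite derD opprD addrACA. Qed.

Lemma bracketZr F c D : bracket F (c *: D) = c *: bracket F D.
Proof. by apply: der_ext => p /=; rewrite derZ scalerBr. Qed.

Lemma bracketBr F D E : bracket F (D - E) = bracket F D - bracket F E.
Proof. by rewrite -scaleN1r bracketDr bracketZr scaleN1r. Qed.

Lemma derE D p : D p = \sum_i coef D i * p^`M(i).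
Proof. by rewrite -{1}[D]vfield_coef. Qed.

Lemma mderivXU a i : ('X_a : A)^`M(i) = (a == i)%:R.
Proof.
rewrite mderivX mnm1E; case: eqP => [->|_]; last by rewrite scale0r.
rewrite scale1r -[RHS]mpolyX0; congr 'X_[_].
by apply/mnmP => j; rewrite mnmBE subnn mnm0E.
Qed.

Lemma mderiv1 i : (1 : A)^`M(i) = 0.
Proof. by rewrite -mpolyC1 mderivC. Qed.

(** Monomials are eigenvectors of each x_i d_i; all weights below come from
    this. *)
Lemma X_mderiv_monomial i (m : 'X_{1..n}) :
  'X_i * 'X_[m]^`M(i) = (m i)%:R *: ('X_[m] : A).
Proof.
rewrite mderivX -scalerAr -mpolyXD.
case: (eqVneq (m i) 0%N) => [->|mi]; first by rewrite !scale0r.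
by rewrite addmC submK // lep1mP.
Qed.

Lemma mcoeffMXU0 p j (m : 'X_{1..n}) : m j = 0%N -> (p * 'X_j)@_m = 0.
Proof.
move=> mj; apply/memN_msupp_eq0; rewrite (perm_mem (msuppMX _ _)).
by apply/mapP => -[m' _ em]; move: mj; rewrite em mnmDE mnm1E eqxx.
Qed.

Definition term p j : Der K n := vfield (fun i => if i == j then p else 0).

Lemma coef_term p j i : coef (term p j) i = if i == j then p else 0.
Proof. by rewrite coef_vfield. Qed.

Lemma term_fun p j q : term p j q = p * q^`M(j).
Proof.
rewrite /= /vfield_fun (bigD1 j) //= eqxx big1 ?addr0 // => i /negPf ->.
by rewrite mul0r.
Qed.

Lemma termD p q j : term (p + q) j = term p j + term q j.
Proof.
apply: der_eq => i; rewrite der_coefD !coef_term.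
by case: ifP => // _; rewrite addr0.
Qed.

Lemma termZ c p j : term (c *: p) j = c *: term p j.
Proof.
apply: der_eq => i; rewrite der_coefZ !coef_term.
by case: ifP => // _; rewrite scaler0.
Qed.

Lemma term0 j : term 0 j = 0.
Proof. by apply: der_eq => i; rewrite der_coef0 coef_term if_same. Qed.

Lemma der_sum_term D : D = \sum_j term (coef D j) j.
Proof.
apply: der_eq => i; rewrite der_coef_sum (bigD1 i) // coef_term eqxx.
rewrite big1 => [|j ji]; first by rewrite /= addr0.
by rewrite coef_term eq_sym (negPf ji).
Qed.

Lemma bracket_term p i q j :
  bracket (term p i) (term q j) = term (p * q^`M(i)) j - term (q * p^`M(j)) i.
Proof.
apply: der_eq => l.
rewrite coef_bracket der_coefD der_coefN !term_fun !coef_term.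
by do 2![case: ifP => _]; rewrite ?mderiv0 ?mulr0.
Qed.

(** For p = x^w these are the fields of torus weight w: the n fields
    x^w x_i d_i all have the same weight, whereas a field x^m d_j with m_j = 0
    is alone in its weight space. *)
Definition wdiag p (c : 'I_n -> K) : Der K n :=
  vfield (fun i => c i *: (p * 'X_i)).

Lemma coef_wdiag p c i : coef (wdiag p c) i = c i *: (p * 'X_i).
Proof. by rewrite coef_vfield. Qed.

Lemma bracket_d_wdiag i p c :
  bracket (term 1 i) (wdiag p c) =
  vfield (fun l => c l *: (p^`M(i) * 'X_l + (l == i)%:R * p)).
Proof.
apply: der_eq => l; rewrite coef_bracket coef_vfield term_fun mul1r.
rewrite coef_wdiag coef_term mderivZ mderivM mderivXU.
have -> : wdiag p c (if l == i then 1 else 0) = 0.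
  by case: ifP => _; rewrite ?der1 ?der0.
by rewrite subr0 [_%:R * p]mulrC.
Qed.

Lemma bracket_shear_wdiag a b p c :
  bracket (term 'X_a b) (wdiag p c) =
  vfield (fun l => c l *: ('X_a * p^`M(b) * 'X_l)
                   + ((l == b)%:R * (c b - c a)) *: (p * 'X_a)).
Proof.
apply: der_eq => l; rewrite coef_bracket coef_vfield term_fun.
rewrite coef_wdiag coef_term mderivZ mderivM mderivXU.
have -> : wdiag p c (if l == b then 'X_a else 0) =
          (l == b)%:R * (c a *: (p * 'X_a)).
  by case: ifP => _; rewrite ?der0 ?mul0r // mul1r -coef_wdiag.
rewrite -!mul_mpolyC mpolyCM mpolyCB mpolyC_nat.
case: eqP => [->|_]; rewrite ?mulr1n ?mulr0n; ring.
Qed.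

End Fields.

(** * Subalgebras that contain the affine fields *)

Section Subalgebra.
Variables (K : fieldType) (n : nat).
Hypothesis K0 : [pchar K] =i pred0.
Local Notation A := {mpoly K[n]}.
Implicit Types (D E : Der K n) (p q r s : A) (i j a b : 'I_n).

Variable S : Der K n -> Prop.
Hypothesis SL : lie_subalgebra S.
Hypothesis Saff : forall D, W_affine D -> S D.

Lemma natK_eq0 m : (m%:R == 0 :> K) = (m == 0%N).
Proof. by move/pcharf0P: K0 => ->. Qed.

Lemma natK_inj : injective (fun m => m%:R : K).
Proof.
move=> m1 m2 /= e; apply/eqP; wlog le12 : m1 m2 e / (m1 <= m2)%N.
  by case/orP: (leq_total m1 m2) => le h; [|rewrite eq_sym]; apply: h.
rewrite eqn_leq le12 /= -subn_eq0 -natK_eq0 natrB // e subrr //.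
Qed.

Lemma S_opp D : S D -> S (- D).
Proof. by rewrite -scaleN1r; apply: lie_scale. Qed.

Lemma S_sub D E : S D -> S E -> S (D - E).
Proof. by move=> SD SE; apply: lie_add => //; apply: S_opp. Qed.

Lemma S_sum (I : Type) (r : seq I) (P : pred I) (F : I -> Der K n) :
  (forall t, P t -> S (F t)) -> S (\sum_(t <- r | P t) F t).
Proof.
by move=> SF; apply: big_ind => // [|D E]; [apply: lie_zero | apply: lie_add].
Qed.

Lemma S_scaleK c D : c != 0 -> S (c *: D) -> S D.
Proof.
by move=> c0 /(lie_scale SL c^-1); rewrite scalerA mulVf // scale1r.
Qed.

(** The Lagrange interpolation argument: a polynomial in phi that vanishes at
    all eigenvalues except mu acts on the eigenspace of mu as a nonzero scalar
    and kills the other eigenvectors. *)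
Lemma S_eigencomponent (T : finType) (v : T -> Der K n)
    (phi : Der K n -> Der K n) (lam : T -> K) (P : pred T) (mu : K) :
  (forall D E, phi (D + E) = phi D + phi E) ->
  (forall c D, phi (c *: D) = c *: phi D) ->
  (forall D, S D -> S (phi D)) ->
  (forall t, phi (v t) = lam t *: v t) ->
  S (\sum_(t | P t) v t) -> S (\sum_(t | P t && (lam t == mu)) v t).
Proof.
move=> phiD phiZ Sphi eig Sv.
have phi0 : phi 0 = 0 by have := phiZ 0 0; rewrite !scale0r.
have phi_sum (Q : pred T) (F : T -> Der K n) :
    phi (\sum_(t | Q t) F t) = \sum_(t | Q t) phi (F t).
  exact: (big_morph phi).
pose c rs t := \prod_(rho <- rs) (lam t - rho).
have Src rs : S (\sum_(t | P t) c rs t *: v t).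
  elim: rs => [|rho rs IH].
    by under eq_bigr do rewrite /c big_nil scale1r.
  have -> : \sum_(t | P t) c (rho :: rs) t *: v t =
      phi (\sum_(t | P t) c rs t *: v t) - rho *: \sum_(t | P t) c rs t *: v t.
    rewrite phi_sum scaler_sumr -sumrB; apply: eq_bigr => t _.
    by rewrite phiZ eig /c big_cons !scalerA -scalerBl mulrBl [lam t * _]mulrC.
  by apply: S_sub; [apply: Sphi | apply: lie_scale].
(* The product over rs is the interpolation polynomial with the single
   surviving node mu. *)
pose rs := [seq rho <- [seq lam t | t : T] | rho != mu].
pose d := \prod_(rho <- rs) (mu - rho).
have d0 : d != 0.
  rewrite prodf_seq_neq0; apply/allP => rho.
  by rewrite mem_filter => /andP[rmu _]; rewrite subr_eq0 eq_sym.
apply: (@S_scaleK d) => //.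
suff -> : d *: \sum_(t | P t && (lam t == mu)) v t =
    \sum_(t | P t) c rs t *: v t.
  exact: Src.
rewrite scaler_sumr big_mkcondr; apply: eq_bigr => t Pt.
case: eqP => [lt | /eqP lt]; first by rewrite /c lt.
have -> : c rs t = 0; last by rewrite scale0r.
apply/eqP; rewrite prodf_seq_eq0; apply/hasP.
exists (lam t); rewrite ?subrr ?eqxx //.
by rewrite mem_filter lt map_f ?mem_enum.
Qed.

Lemma S_affine_term p j : (msize p <= 2)%N -> S (term p j).
Proof.
move=> sp; apply: Saff => i; rewrite coef_term; case: ifP => // _.
by rewrite msize0.
Qed.

Lemma S_partial j : S (term 1 j).
Proof. by apply: S_affine_term; rewrite msize1. Qed.

Lemma S_linear_term a j : S (term 'X_a j).
Proof. by apply: S_affine_term; rewrite msizeX mdeg1. Qed.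

(** The weight of x^m d_j is m - e_j, and two weights m - e_j and m0 - e_j0
    agree exactly when m + e_j0 = m0 + e_j, which avoids negative exponents.
    The eigenvalues of the n operators ad (x_i d_i) separate the weights
    because the characteristic is zero, so cutting out the eigencomponents one
    coordinate at a time isolates a weight. *)
Lemma S_weight_component (T : finType) (mo : T -> 'X_{1..n}) (ix : T -> 'I_n)
   (x : T -> K) (m0 : 'X_{1..n}) j0 :
  S (\sum_t x t *: term 'X_[mo t] (ix t)) ->
  S (\sum_(t | (mo t + U_(j0) == m0 + U_(ix t))%MM)
       x t *: term 'X_[mo t] (ix t)).
Proof.
move=> Sv; pose v t := x t *: term 'X_[mo t] (ix t).
pose lam i t : K := (mo t i)%:R - (i == ix t)%:R.
pose mu i : K := (m0 i)%:R - (i == j0)%:R.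
have eig i t : bracket (term 'X_i i) (v t) = lam i t *: v t.
  rewrite /v /lam bracketZr bracket_term scalerA [lam i t * _]mulrC -scalerA.
  congr (_ *: _).
  rewrite scalerBl; congr (_ - _).
    by rewrite -termZ X_mderiv_monomial.
  rewrite mderivXU; case: eqP => [->|_]; rewrite ?scale1r ?mulr1 //.
  by rewrite scale0r mulr0 term0.
pose sel t := all (fun i => lam i t == mu i).
have step (s : seq 'I_n) : S (\sum_(t | sel t s) v t).
  elim: s => [|i s IH] //=.
  rewrite (eq_bigl (fun t => sel t s && (lam i t == mu i))); last first.
    by move=> t; rewrite andbC.
  apply: (@S_eigencomponent _ _ (bracket (term 'X_i i)) _ _ _ _ _ _ (eig i));
    last exact: IH.
  - exact: bracketDr.
  - exact: bracketZr.
  - by move=> D; apply: lie_bracket => //; apply: S_linear_term.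
rewrite (eq_bigl (sel^~ (enum 'I_n))); first exact: step.
move=> t; apply/eqP/allP => [e i _ | h].
  rewrite /lam /mu subr_eq addrAC eq_sym subr_eq -!natrD.
  by move/mnmP/(_ i): e; rewrite !mnmDE !mnm1E ![_ == i]eq_sym => ->.
apply/mnmP => i; rewrite !mnmDE !mnm1E ![_ == i]eq_sym.
have := h i (mem_enum _ i).
rewrite /lam /mu subr_eq addrAC eq_sym subr_eq -!natrD.
by move/eqP/natK_inj.
Qed.

Hypothesis n2 : (2 <= n)%N.

Lemma exists_other a : exists b, b != a.
Proof.
pose i0 : 'I_n := Ordinal (ltnW n2); pose i1 : 'I_n := Ordinal n2.
by case: (eqVneq a i0) => [->|a0]; [exists i1 | exists i0; rewrite eq_sym].
Qed.

Lemma der_sum_monomials D d : (forall j, msize (coef D j) <= d)%N ->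
  D = \sum_(t : 'X_{1..n < d} * 'I_n) (coef D t.2)@_t.1 *: term 'X_[t.1] t.2.
Proof.
move=> hd; rewrite {1}[D]der_sum_term.
rewrite -(pair_big xpredT xpredT
  (fun (m : 'X_{1..n < d}) j => (coef D j)@_m *: term 'X_[m] j)) /=.
rewrite exchange_big; apply: eq_bigr => j _.
rewrite {1}(mpolywE (hd j)).
rewrite (big_morph (fun p => term p j) (fun p q => termD p q j) (term0 _ j)).
by apply: eq_bigr => m _; rewrite termZ.
Qed.

Lemma S_weight_part D d m0 j0 : (forall j, msize (coef D j) <= d)%N -> S D ->
  S (\sum_(t : 'X_{1..n < d} * 'I_n | (t.1 + U_(j0) == m0 + U_(t.2))%MM)
       (coef D t.2)@_t.1 *: term 'X_[t.1] t.2).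
Proof.
move=> hd; rewrite {1}(der_sum_monomials hd).
exact: (@S_weight_component _
  (fun t : 'X_{1..n < d} * 'I_n => t.1 : 'X_{1..n}) snd
  (fun t => (coef D t.2)@_t.1) m0 j0).
Qed.

(** The summand e makes room for the exponents of a prescribed weight space
    that do not occur in D. *)
Definition der_bound D e := (\max_j msize (coef D j) + e)%N.

Lemma der_boundP D e j : (msize (coef D j) <= der_bound D e)%N.
Proof. by apply: leq_trans (leq_addr _ _); apply: (leq_bigmax j). Qed.

(** If m_j = 0 then the weight m - e_j has a negative entry at j, so x^m d_j
    is the only monomial field of this weight. *)
Lemma S_weight_monomial D (m : 'X_{1..n}) j :
  S D -> m j = 0%N -> (coef D j)@_m != 0 -> S (term 'X_[m] j).
Proof.
move=> SD mj mD; apply: (S_scaleK mD).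
have := S_weight_part m j (der_boundP D (mdeg m).+1) SD.
have mb : (mdeg m < der_bound D (mdeg m).+1)%N by exact: leq_addl.
rewrite (big_pred1 (BMultinom mb, j)) // => -[[m' m'b] j'].
rewrite /= xpair_eqE -[BMultinom _ == _]val_eqE /=.
apply/eqP/andP => [e | [/eqP e1 /eqP ->]]; last by rewrite -e1.
have jj : j' = j.
  apply/eqP; move/mnmP/(_ j): e; rewrite !mnmDE !mnm1E eqxx mj.
  by case: eqP; rewrite ?addn1.
by split; apply/eqP => //; move: e; rewrite jj => /addIm.
Qed.

Lemma S_weight_wdiag D w : S D ->
  S (wdiag 'X_[w] (fun j => (coef D j)@_(w + U_(j)))).
Proof.
move=> SD; pose j0 : 'I_n := Ordinal (ltnW n2).
have := S_weight_part (w + U_(j0)) j0 (der_boundP D (mdeg w).+2) SD.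
set d := der_bound _ _.
have wb j : (mdeg (w + U_(j)) < d)%N by rewrite mdegD mdeg1 addn1 leq_addl.
rewrite (reindex_onto (fun j => (BMultinom (wb j), j)) snd);
    last move=> [[m mb] j] /=; last first.
  rewrite addmAC => /eqP/addIm e; congr (_, _); exact: val_inj.
rewrite (eq_bigl xpredT) => [|j]; last by rewrite /= addmAC !eqxx.
set E := \sum_(_ | _) _.
suff -> : E = wdiag 'X_[w] (fun j => (coef D j)@_(w + U_(j))) by [].
apply: der_eq => i; rewrite der_coef_sum (bigD1 i) //.
rewrite big1 => [|j ji]; last first.
  by rewrite der_coefZ coef_term eq_sym (negPf ji) scaler0.
by rewrite der_coefZ coef_term eqxx coef_wdiag mpolyXD [LHS]addr0.
Qed.

(** * From a weight vector to x_a^2 d_b *)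

Lemma S_bracket p i q j r s : S (term p i) -> S (term q j) ->
  p * q^`M(i) = r -> q * p^`M(j) = s -> S (term r j - term s i).
Proof. by move=> Sp Sq <- <-; rewrite -bracket_term; apply: lie_bracket. Qed.

Lemma S_bracket0 p i q j r : S (term p i) -> S (term q j) ->
  p * q^`M(i) = r -> p^`M(j) = 0 -> S (term r j).
Proof.
move=> Sp Sq e e0; rewrite -[term r j]subr0 -(term0 _ i).
by apply: (S_bracket Sp Sq) => //; rewrite e0 mulr0.
Qed.

Lemma S_term_scale c p j : c != 0 -> S (term (c *: p) j) -> S (term p j).
Proof. by move=> c0; rewrite termZ; apply: S_scaleK. Qed.

Lemma mdegS_split d (m : 'X_{1..n}) : mdeg m = d.+1 ->
  exists i m', m = (m' + U_(i))%MM /\ mdeg m' = d.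
Proof.
move=> md; have [i mi|m0] := pickP (fun i => m i != 0%N).
  exists i, (m - U_(i))%MM; have e : m = (m - U_(i) + U_(i))%MM.
    by rewrite submK // lep1mP.
  by split => //; move: md; rewrite {1}e mdegD mdeg1 addn1 => -[].
by move: md; rewrite mdegE big1 // => i _; apply/eqP; move/negbFE: (m0 i).
Qed.

Lemma mdeg1_split (m : 'X_{1..n}) : mdeg m = 1%N -> exists i, m = U_(i)%MM.
Proof. by move/eqP/mdeg1P => [i /eqP ->]; exists i. Qed.

Lemma S_mderiv p i j : S (term p j) -> S (term p^`M(i) j).
Proof.
move=> Sp; apply: (S_bracket0 (S_partial i) Sp); rewrite ?mul1r //.
by rewrite -mpolyC1 mderivC.
Qed.

(** Partial derivatives lower the degree of m to 2 while keeping m_b = 0, and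
    x_i d_j turns x_i x_j d_b into x_i^2 d_b. *)
Lemma S_square_of_monomial d (m : 'X_{1..n}) b :
  mdeg m = d.+2 -> m b = 0%N -> S (term 'X_[m] b) ->
  exists2 a, a != b & S (term ('X_a * 'X_a) b).
Proof.
elim: d m => [|d IH] m md mb Sm; have [i [m' [em m'd]]] := mdegS_split md.
  have [j ej] := mdeg1_split m'd; rewrite {}em {}ej {m' m'd md} in mb Sm.
  move: mb; rewrite mnmDE !mnm1E => /eqP.
  rewrite addn_eq0 !eqb0 => /andP[jb ib].
  exists i => //; rewrite mpolyXD in Sm.
  case: (eqVneq i j) => [ij|ij]; first by rewrite {2}ij mulrC.
  apply: (S_bracket0 (S_linear_term i j) Sm); last first.
    by rewrite mderivXU (negPf ib).
  by rewrite mderivM !mderivXU eqxx (negPf ij) mul1r mulr0 addr0.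
have m'b : m' b = 0%N by move/eqP: mb; rewrite em mnmDE addn_eq0 => /andP[/eqP].
apply: (IH _ m'd m'b); apply: (@S_term_scale (m i)%:R).
  by rewrite natK_eq0 em mnmDE mnm1E eqxx addn1.
have -> : m' = (m - U_(i))%MM by rewrite em addmK.
by rewrite -mderivX; apply: S_mderiv.
Qed.

(** Put h = sum_l c_l x_l d_l.  Then
      [x_a d_b, x^w h]
        = w_b x^(w - e_b + e_a) h + (c_b - c_a) x^(w + e_a) d_b.
    If w_b = 0 only the second term remains.  Otherwise the right-hand side is
    again of the form x^w' h' with w'_b = w_b - 1, and c'_a - c'_b is
    c_a - c_b times w_b + 1; so induction on w_b applies. *)
Lemma S_shear (w : 'X_{1..n}) c a b : a != b -> c a != c b -> (0 < mdeg w)%N ->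
  S (wdiag 'X_[w] c) -> exists2 m : 'X_{1..n},
    mdeg m = (mdeg w).+1 /\ m b = 0%N & S (term 'X_[m] b).
Proof.
move=> ab; move wb: (w b) => k.
elim: k w c wb => [|k IH] w c wb cab w0 Sw;
  have Sb := lie_bracket SL (S_linear_term a b) Sw;
  rewrite bracket_shear_wdiag in Sb.
  exists (w + U_(a))%MM.
    by rewrite mdegD mdeg1 addn1 mnmDE wb mnm1E (negPf ab).
  apply: (@S_term_scale (c b - c a)); first by rewrite subr_eq0 eq_sym.
  suff -> : term ((c b - c a) *: 'X_[w + U_(a)]) b = vfield
     (fun l => c l *: ('X_a * 'X_[w]^`M(b) * 'X_l)
                   + ((l == b)%:R * (c b - c a)) *: ('X_[w] * 'X_a)) by [].
  apply: der_eq => l; rewrite coef_term coef_vfield mderivX wb scale0r.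
  rewrite mulr0 mul0r scaler0 add0r mpolyXD.
  by case: eqP; rewrite ?mul1r // mul0r scale0r.
have [w' ew] : exists w', w = (w' + U_(b))%MM.
  by exists (w - U_(b))%MM; rewrite submK // lep1mP wb.
have w'b : w' b = k by move: wb; rewrite ew mnmDE mnm1E eqxx addn1 => -[].
pose c' l := k.+1%:R * c l + (l == b)%:R * (c b - c a).
have [||||m [md mb] Sm] := IH (w' + U_(a))%MM c'.
- by rewrite mnmDE w'b mnm1E (negPf ab) addn0.
- rewrite /c' (negPf ab) eqxx mul0r addr0 mul1r -subr_eq0.
  have -> : k.+1%:R * c a - (k.+1%:R * c b + (c b - c a)) =
      k.+2%:R * (c a - c b).
    by rewrite -[k.+2%:R]natr1; ring.
  by rewrite mulf_neq0 ?natK_eq0 // subr_eq0.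
- by rewrite mdegD mdeg1 addn1.
- suff <- : vfield
     (fun l => c l *: ('X_a * 'X_[w]^`M(b) * 'X_l)
                   + ((l == b)%:R * (c b - c a)) *: ('X_[w] * 'X_a)) =
     wdiag 'X_[(w' + U_(a))] c' by [].
  apply: der_eq => l; rewrite coef_wdiag coef_vfield mderivX wb ew addmK.
  rewrite !mpolyXD.
  rewrite -!mul_mpolyC !mpolyCD !mpolyCM mpolyCB !mpolyC_nat.
  by case: eqP => [->|_]; rewrite ?mulr1n ?mulr0n; ring.
by exists m => //; rewrite md ew !mdegD !mdeg1.
Qed.

(** x_a^2 d_b with a <> b is an extremal weight vector of the irreducible
    gl_n-module of quadratic fields of divergence zero; having one is the same
    as having that whole module. *)
Definition has_square := exists a b, a != b /\ S (term ('X_a * 'X_a) b).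

Lemma square_of_monomial (m : 'X_{1..n}) b : (1 < mdeg m)%N -> m b = 0%N ->
  S (term 'X_[m] b) -> has_square.
Proof.
case md: (mdeg m) => [|[|d]] // _ mb Sm.
by have [a ab Sa] := S_square_of_monomial md mb Sm; exists a, b.
Qed.

Lemma square_of_wdiag (w : 'X_{1..n}) c a b : (0 < mdeg w)%N -> c a != c b ->
  S (wdiag 'X_[w] c) -> has_square.
Proof.
move=> w0 cab Sw; have ab : a != b by apply: contraNneq cab => ->.
have [m [md mb]] := S_shear ab cab w0 Sw.
by apply: square_of_monomial => //; rewrite md.
Qed.

Lemma S_wdiag_partial (w : 'X_{1..n}) i c : S (wdiag 'X_[w + U_(i)] c) ->
  S (wdiag 'X_[w] (fun l => c l * ((w i).+1 + (l == i))%:R)).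
Proof.
move/(lie_bracket SL (S_partial i)); rewrite bracket_d_wdiag.
suff -> : wdiag 'X_[w] (fun l => c l * ((w i).+1 + (l == i))%:R) = vfield
    (fun l => c l *: ('X_[w + U_(i)]^`M(i) * 'X_l
                      + (l == i)%:R * 'X_[w + U_(i)])) by [].
apply: der_eq => l; rewrite coef_wdiag coef_vfield mderivX mnmDE mnm1E eqxx.
rewrite addn1 addmK mpolyXD -!mul_mpolyC mpolyCM !mpolyC_nat natrD.
by case: eqP => [->|_]; rewrite ?mulr1n ?mulr0n; ring.
Qed.

(** The case of constant c, that is of x^w E_n: its bracket with d_i, where
    w_i > 0, is x^(w - e_i) (w_i E_n + x_i d_i), whose diagonal part is no
    longer constant as n >= 2. *)
Lemma square_of_wdiag2 (w : 'X_{1..n}) c j : (1 < mdeg w)%N -> c j != 0 ->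
  S (wdiag 'X_[w] c) -> has_square.
Proof.
move=> w1 cj Sw; case: (pickP (fun a => c a != c j)) => [a caj | cst].
  by apply: square_of_wdiag caj Sw; apply: ltnW.
case md: (mdeg w) w1 => [|[|d]] // _; have [i [w' [ew w'd]]] := mdegS_split md.
have [b bi] := exists_other i; rewrite ew in Sw.
have cE l : c l = c j by apply/eqP; move/negbFE: (cst l).
apply: (@square_of_wdiag w' _ i b) (S_wdiag_partial Sw); first by rewrite w'd.
rewrite !cE eqxx (negPf bi) -subr_eq0 -mulrBr mulf_neq0 // subr_eq0.
by apply/eqP => /natK_inj/eqP; rewrite eqn_add2l.
Qed.

(** * Quadratic fields *)

Section FromSquare.
Hypothesis sq : has_square.

(** The bracket of x_a^2 d_b with x_b d_d replaces b by any d <> a.  Changing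
    the variable a is done by applying ad (x_b d_a) three times to x_a^2 d_b,
    which gives - 6 x_b^2 d_a: this needs no third index, so it also works for
    n = 2. *)
Lemma S_square a b : a != b -> S (term ('X_a * 'X_a) b).
Proof.
have chg_d a' b' d : a' != b' -> a' != d ->
    S (term ('X_a' * 'X_a') b') -> S (term ('X_a' * 'X_a') d).
  move=> ab ad Sab; apply: (S_bracket0 Sab (S_linear_term b' d)).
    by rewrite mderivXU eqxx mulr1.
  by rewrite mderivM mderivXU (negPf ad) mul0r mulr0 addr0.
have flip a' b' : a' != b' -> S (term ('X_a' * 'X_a') b') ->
    S (term ('X_b' * 'X_b') a').
  move=> ab Sab; have ba : b' != a' by rewrite eq_sym.
  have S1 := lie_bracket SL (S_linear_term b' a') Sab.
  have S2 := lie_bracket SL (S_linear_term b' a') S1.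
  have S3 := lie_bracket SL (S_linear_term b' a') S2.
  apply: (@S_term_scale (- 6%:R)); first by rewrite oppr_eq0 natK_eq0.
  move: S3; rewrite (_ : bracket _ _ = term (- 6%:R *: ('X_b' * 'X_b')) a') //.
  rewrite !(bracketBr, bracket_term).
  apply: der_eq => l; rewrite !(der_coefD, der_coefN, coef_term).
  rewrite !(mderivM, mderivD, mderivXU, eqxx, negPf ba, mulr1n, mulr0n) /=.
  rewrite !(mderiv1, mderiv0) -mul_mpolyC mpolyCN mpolyC_nat.
  case: (eqVneq l b') => [->|_]; first by rewrite (negPf ba); ring.
  by case: eqP => _; ring.
move=> ab; case: sq => [a' [b' [ab' Sab']]].
case: (eqVneq a a') => [ea|aa].
  by rewrite ea in ab *; exact: chg_d ab' ab Sab'.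
have Saa := chg_d a' b' a ab'.
have {Saa}Saa : S (term ('X_a * 'X_a) a').
  by apply: flip; [rewrite eq_sym | apply: Saa; rewrite // eq_sym].
exact: chg_d Saa.
Qed.

Lemma S_cross a b d : a != d -> b != d -> S (term ('X_a * 'X_b) d).
Proof.
move=> ad bd; case: (eqVneq a b) => [<-|ab]; first exact: S_square.
apply: (@S_term_scale 2%:R); first by rewrite natK_eq0.
apply: (S_bracket0 (S_linear_term b a) (S_square ad)); last first.
  by rewrite mderivXU (negPf bd).
by rewrite mderivM mderivXU eqxx mulr1n -mul_mpolyC mpolyC_nat; ring.
Qed.

(** Together with the fields of [S_square] and [S_cross] these span the
    quadratic fields of divergence zero. *)
Lemma S_trace_free a b : a != b ->
  S (term ('X_a * 'X_a) a - 2%:R *: term ('X_a * 'X_b) b).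
Proof.
move=> ab; rewrite -termZ; apply: (S_bracket (S_square ab) (S_linear_term b a)).
  by rewrite mderivXU eqxx mulr1.
by rewrite mderivM mderivXU eqxx mulr1n -mul_mpolyC mpolyC_nat; ring.
Qed.

(** The sum is the divergence of x^w (sum_l c_l x_l d_l) divided by x^w.
    Divergence commutes with the bracket by d_i, which multiplies this sum by
    the positive exponent of x_i; so it stays nonzero down to degree 1. *)
Lemma linear_of_wdiag (w : 'X_{1..n}) c : (0 < mdeg w)%N ->
  \sum_l c l * (w l).+1%:R != 0 -> S (wdiag 'X_[w] c) ->
  exists a e, \sum_l e l * (U_(a)%MM l).+1%:R != 0 :> K /\ S (wdiag 'X_a e).
Proof.
case md: (mdeg w) => [|d] // _; elim: d w md c => [|d IH] w md c tr Sw.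
  by have [a ea] := mdeg1_split md; exists a, c; rewrite -ea.
have [i [w' [ew w'd]]] := mdegS_split md; rewrite {}ew {w md} in tr Sw.
apply: (IH _ w'd _ _ (S_wdiag_partial Sw)).
suff -> : \sum_l c l * ((w' i).+1 + (l == i))%:R * (w' l).+1%:R =
   (w' i).+1%:R * \sum_l c l * ((w' + U_(i))%MM l).+1%:R.
  by rewrite mulf_neq0 // natK_eq0.
rewrite mulr_sumr; apply: eq_bigr => l _; rewrite -mulrA [RHS]mulrCA.
congr (_ * _); rewrite -!natrM; congr (_%:R).
rewrite mnmDE mnm1E eq_sym; case: eqP => [->|_]; last by rewrite !addn0.
by rewrite !addn1 mulnC.
Qed.

Section FromDivergence.
Variables (a0 : 'I_n) (e0 : 'I_n -> K).
Hypothesis tr0 : \sum_l e0 l * (U_(a0)%MM l).+1%:R != 0.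
Hypothesis S0 : S (wdiag 'X_a0 e0).

Let half x : 2%:R^-1 * (x * 2%:R) = x :> K.
Proof. by rewrite mulrCA mulVf ?mulr1 // natK_eq0. Qed.

Lemma S_self0 : S (term ('X_a0 * 'X_a0) a0).
Proof.
pose d := \sum_l e0 l * (U_(a0)%MM l).+1%:R.
have d0 : 2%:R^-1 * d != 0 by rewrite mulf_neq0 // invr_eq0 natK_eq0.
apply: (S_scaleK d0).
(* Adding e0 b / 2 times the trace-free field of index b cancels the term
   (e0 b) x_a0 x_b d_b and adds e0 b / 2 to the coefficient of x_a0^2 d_a0; the
   final coefficient is half of the divergence. *)
have St : S (\sum_(b | b != a0)
    (2%:R^-1 * e0 b) *:
      (term ('X_a0 * 'X_a0) a0 - 2%:R *: term ('X_a0 * 'X_b) b)).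
  apply: S_sum => b ba; apply: lie_scale => //; apply: S_trace_free.
  by rewrite eq_sym.
have := lie_add SL S0 St; set E := _ + _.
suff -> : E = (2%:R^-1 * d) *: term ('X_a0 * 'X_a0) a0 by [].
apply: der_eq => l.
rewrite der_coefD coef_wdiag der_coef_sum der_coefZ coef_term.
case: eqP => [->|/eqP la].
  rewrite [d](bigD1 a0) // mnm1E eqxx mulrDr half scalerDl; congr (_ + _).
  rewrite mulr_sumr scaler_suml; apply: eq_bigr => b ba.
  rewrite der_coefZ der_coefD der_coefN der_coefZ !coef_term eqxx eq_sym.
  by rewrite (negPf ba) scaler0 subr0 mnm1E eq_sym (negPf ba) mulr1.
rewrite scaler0 (bigD1 l) // big1 => [|b /andP[ba bl]]; last first.
  rewrite der_coefZ der_coefD der_coefN der_coefZ !coef_term (negPf la).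
  by rewrite eq_sym (negPf bl) scaler0 subr0 scaler0.
rewrite der_coefZ der_coefD der_coefN der_coefZ !coef_term (negPf la) eqxx.
rewrite sub0r [X in _ + X]addr0.
by rewrite scalerN scalerA -mulrA half subrr.
Qed.

Lemma S_self_of a : S (term ('X_a * 'X_a) a) ->
  forall b, S (term ('X_a * 'X_b) b).
Proof.
move=> Sa b; case: (eqVneq a b) => [<-|ab] //.
apply: (@S_term_scale 2%:R); first by rewrite natK_eq0.
rewrite termZ; have := S_sub Sa (S_trace_free ab).
by rewrite opprB addrC subrK.
Qed.

Lemma S_self a : S (term ('X_a * 'X_a) a).
Proof.
case: (eqVneq a a0) => [->|aa0]; first exact: S_self0.
suff Saa : S (term ('X_a * 'X_a0) a0).
  have := lie_add SL (S_trace_free aa0) (lie_scale SL 2%:R Saa).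
  by rewrite subrK.
apply: (@S_term_scale 2%:R); first by rewrite natK_eq0.
apply: (S_bracket0 (S_linear_term a a0) S_self0); last first.
  by rewrite mderivXU (negPf aa0).
by rewrite mderivM mderivXU eqxx mulr1n -mul_mpolyC mpolyC_nat; ring.
Qed.

Lemma S_quad a b d : S (term ('X_a * 'X_b) d).
Proof.
case: (eqVneq b d) => [->|bd]; first exact: S_self_of (S_self a) d.
case: (eqVneq a d) => [->|ad]; last exact: S_cross.
by rewrite mulrC; apply: S_self_of (S_self b) d.
Qed.

(** * Raising the degree *)

Definition full d := forall (m : 'X_{1..n}) j, mdeg m = d -> S (term 'X_[m] j).

Lemma full_quadratic : full 2.
Proof.
move=> m j md; have [i [m' [-> m'd]]] := mdegS_split md.
by have [l ->] := mdeg1_split m'd; rewrite mpolyXD; apply: S_quad.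
Qed.

(** [x^m d_j, x_j^2 d_j] = (2 - m_j) x^m x_j d_j. *)
Lemma S_mul_self d (m : 'X_{1..n}) j : full d -> mdeg m = d -> m j != 2%N ->
  S (term ('X_[m] * 'X_j) j).
Proof.
move=> fd md mj; apply: (@S_term_scale (2%:R - (m j)%:R)).
  by rewrite subr_eq0; apply: contra mj => /eqP/natK_inj <-.
rewrite scalerBl -scaleN1r termD [term (-1 *: _) j]termZ scaleN1r.
apply: (S_bracket (fd m j md) (S_quad j j j)).
  by rewrite mderivM mderivXU eqxx mulr1n -mul_mpolyC mpolyC_nat; ring.
by rewrite -mulrA X_mderiv_monomial -scalerAr mulrC.
Qed.

(** [x^m d_j, x_i x_j d_j] = (1 - m_j) x^m x_i d_j. *)
Lemma S_mul_other d (m : 'X_{1..n}) i j : full d -> mdeg m = d -> i != j ->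
  m j != 1%N -> S (term ('X_[m] * 'X_i) j).
Proof.
move=> fd md ij mj; apply: (@S_term_scale (1 - (m j)%:R)).
  by rewrite subr_eq0; apply: contra mj => /eqP/(@natK_inj 1) <-.
rewrite scalerBl -scaleN1r termD [term (-1 *: _) j]termZ scaleN1r scale1r.
apply: (S_bracket (fd m j md) (S_quad i j j)).
  by rewrite mderivM !mderivXU eqxx (negPf ij) mulr1n mulr0n; ring.
by rewrite -mulrA X_mderiv_monomial -scalerAr mulrC.
Qed.

(** Neither of the two formulas above produces x_j^3 d_j; it comes from
    [x_j^2 d_i, x_i x_j d_j] = x_j^3 d_j - 2 x_j^2 x_i d_i, whose last term is
    covered by [S_mul_self]. *)
Lemma S_cube j : full 2 -> S (term ('X_j * 'X_j * 'X_j) j).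
Proof.
move=> f2; have [i ij] := exists_other j.
have Si : S (term ('X_j * 'X_j * 'X_i) i).
  have := @S_mul_self 2 (U_(j) + U_(j))%MM i f2.
  rewrite mdegD !mdeg1 mnmDE mnm1E [j == i]eq_sym (negPf ij) mpolyXD; exact.
rewrite -[term _ j](subrK (2%:R *: term ('X_j * 'X_j * 'X_i) i)).
apply: lie_add => //; last exact: lie_scale.
rewrite -termZ; apply: (S_bracket (S_quad j j i) (S_quad i j j)).
  rewrite mderivM !mderivXU eqxx [j == i]eq_sym (negPf ij) mulr1n mulr0n.
  by ring.
by rewrite mderivM mderivXU eqxx mulr1n -mul_mpolyC mpolyC_nat; ring.
Qed.

(** For x^m d_j, multiplication by x_j works unless m_j is 0 or 3.  For m_j = 0
    and for m_j = 3 one multiplies by another variable that occurs in m, and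
    the only monomial left is x_j^3. *)
Lemma fullS d : full d.+2 -> full d.+3.
Proof.
move=> fd m j md; case: (eqVneq (m j) 3%N) => [mj|mj]; last first.
  case: (eqVneq (m j) 0%N) => [mj0|mj0].
    have [i [m' [em m'd]]] := mdegS_split md.
    have ij : i != j.
      by apply/eqP => ij; move: mj0; rewrite em ij mnmDE mnm1E eqxx addn1.
    rewrite em mpolyXD; apply: S_mul_other fd m'd ij _.
    by move/eqP: mj0; rewrite em mnmDE addn_eq0 => /andP[/eqP ->].
  have em : m = (m - U_(j) + U_(j))%MM by rewrite submK // lep1mP.
  rewrite em mpolyXD; apply: (S_mul_self fd).
    by move: md; rewrite {1}em mdegD mdeg1 addn1 => -[].
  by apply: contra mj => /eqP e; rewrite em mnmDE e mnm1E eqxx.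
case: (pickP (fun i => (i != j) && (m i != 0%N))) => [i /andP[ij mi] | m0].
  have em : m = (m - U_(i) + U_(i))%MM by rewrite submK // lep1mP.
  rewrite em mpolyXD; apply: (S_mul_other fd _ ij).
    by move: md; rewrite {1}em mdegD mdeg1 addn1 => -[].
  by rewrite mnmBE mnm1E (negPf ij) mj.
have em : m = (U_(j) + U_(j) + U_(j))%MM.
  apply/mnmP => i; rewrite !mnmDE !mnm1E eq_sym; case: eqP => [->//|/eqP ij].
  by move/negbT: (m0 i); rewrite ij /= negbK => /eqP.
by rewrite em !mpolyXD; apply: S_cube full_quadratic.
Qed.

Lemma S_all D : S D.
Proof.
have Sf d : full d.+2 by elim: d => [|d /fullS //]; apply: full_quadratic.
rewrite [D]der_sum_term; apply: S_sum => j _.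
elim/mpolyind: (coef D j) => [|c m p _ _ Sp].
  by rewrite term0; apply: lie_zero.
rewrite termD termZ; apply: lie_add => //; apply: lie_scale => //.
case md: (mdeg m) => [|[|d]]; last exact: Sf md.
all: by apply: S_affine_term; rewrite msizeX md.
Qed.

End FromDivergence.
End FromSquare.

(** * From D to the whole algebra *)

Section Sufficiency.
Variable D : Der K n.
Hypothesis SD : S D.

Lemma square_of_high_degree j (m : 'X_{1..n}) : (coef D j)@_m != 0 ->
  (2 < mdeg m)%N -> has_square.
Proof.
move=> cm md; case: (eqVneq (m j) 0%N) => [mj|mj].
  by apply: square_of_monomial mj (S_weight_monomial SD mj cm); apply: ltnW.
have em : m = (m - U_(j) + U_(j))%MM by rewrite submK // lep1mP.
apply: (@square_of_wdiag2 _ _ j _ _ (S_weight_wdiag (m - U_(j))%MM SD)).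
  by move: md; rewrite {1}em mdegD mdeg1 addn1.
by rewrite -em.
Qed.

(** If E = f E_n, then f must be the linear form whose x_a-coefficient is the
    coefficient of x_a^2 d_a in E.  With this f, a monomial of E - f E_n lies
    either in a one-dimensional weight space or in the weight space of some
    x_a, where it witnesses a nonconstant diagonal part. *)
Lemma square_of_quadratic E : W_homog 2 E ->
  (forall (m : 'X_{1..n}) j, mdeg m = 2 -> (coef D j)@_m = (coef E j)@_m) ->
  ~ proportional_to_euler E -> has_square.
Proof.
move=> hE DE nprop.
pose f := \sum_a (coef E a)@_(U_(a) + U_(a)) *: 'X_a : A.
have hf : f \is 1.-homog.
  by apply: rpred_sum => a _; apply: dhomogZ; rewrite dhomogX /= mdeg1.
have [j|eqE] := pickP (fun j => coef E j != f * 'X_j); last first.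
  case: nprop; exists f => p; rewrite !derE mulr_sumr; apply: eq_bigr => j _.
  by rewrite coef_vfield mulrA; congr (_ * _); apply/eqP; move/negbFE: (eqE j).
rewrite -subr_eq0 => /mlead_supp; set g := _ - _; set m := mlead _ => mg.
have md : mdeg m = 2.
  apply: (dhomog_mf _ mg); apply: rpredB => //.
  by apply: (dhomogM hf); rewrite dhomogX /= mdeg1.
move: mg; rewrite mcoeff_msupp mcoeffB subr_eq0 -DE //.
case: (eqVneq (m j) 0%N) => [mj|mj].
  rewrite [X in _ != X]mcoeffMXU0 // => cm.
  by apply: square_of_monomial mj (S_weight_monomial SD mj cm); rewrite md.
have em : m = (m - U_(j) + U_(j))%MM by rewrite submK // lep1mP.
have [a ea] : exists a, (m - U_(j))%MM = U_(a)%MM.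
  by apply: mdeg1_split; move: md; rewrite {1}em mdegD mdeg1 addn1 => -[].
rewrite em ea [X in (f * _)@_X]addmC mcoeffMX.
have -> : f@_U_(a) = (coef E a)@_(U_(a) + U_(a)).
  rewrite /f raddf_sum (bigD1 a) //= big1 => [|b /negPf ba].
    by rewrite mcoeffZ mcoeffXU eqxx mulr1 addr0.
  by rewrite mcoeffZ mcoeffXU ba mulr0.
rewrite -DE ?mdegD ?mdeg1 // => c.
by apply: (square_of_wdiag _ c (S_weight_wdiag U_(a)%MM SD)); rewrite mdeg1.
Qed.

(** The exponent w of a nonconstant monomial of div D selects the component
    x^w (sum_j c_j x_j d_j) of D, and the coefficient of x^w in div D is the
    number required by [linear_of_wdiag]. *)
Lemma S_all_of_square : has_square ->
  ~ (exists c : K, divergence D = c%:MP) -> forall E, S E.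
Proof.
move=> sq nc.
have : divergence D - ((divergence D)@_0)%:MP != 0.
  by apply/eqP => /subr0_eq e; apply: nc; exists (divergence D)@_0.
move/mlead_supp; set w := mlead _; rewrite mcoeff_msupp mcoeffB mcoeffC.
case: (eqVneq w 0%MM) => [->|w0]; first by rewrite mulr1 subrr eqxx.
rewrite mulr0 subr0 raddf_sum /= => tr.
have [|||a [e [tre Sa]]] :=
  @linear_of_wdiag w (fun j => (coef D j)@_(w + U_(j))).
- by rewrite lt0n mdeg_eq0.
- by under eq_bigr do rewrite mulr_natr -mcoeff_deriv.
- exact: S_weight_wdiag.
exact: (S_all sq tre Sa).
Qed.

End Sufficiency.
End Subalgebra.

(** * Two proper subalgebras *)

Section Homogeneous.
Variables (K : fieldType) (n : nat).
Local Notation A := {mpoly K[n]}.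
Implicit Types (D E : Der K n) (p q : A) (i j : 'I_n).

Lemma dhomog_mderiv d p i : p \is d.+1.-homog -> p^`M(i) \is d.-homog.
Proof.
move=> hp; apply/dhomogP => m; rewrite mcoeff_msupp mcoeff_deriv => nz.
suff /(dhomog_mf hp) : (m + U_(i))%MM \in msupp p.
  by rewrite /= mdegD mdeg1 addn1 => -[].
by rewrite mcoeff_msupp; apply: contraNneq nz => ->; rewrite mul0rn.
Qed.

Lemma dhomog_der d m D p :
  W_homog m D -> p \is d.+1.-homog -> D p \is (m + d).-homog.
Proof.
move=> hD hp; rewrite derE; apply: rpred_sum => i _.
exact: dhomogM (hD i) (dhomog_mderiv i hp).
Qed.

Lemma dhomog0P p : reflect (exists c, p = c%:MP) (p \is 0.-homog).
Proof.
apply: (iffP idP) => [hp | [c ->]].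
  exists p@_0; apply/mpolyP => m; rewrite mcoeffC.
  case: (eqVneq m 0%MM) => [->|m0]; first by rewrite mulr1.
  by rewrite mulr0; apply: dhomog_nemf_coeff hp _; rewrite /= mdeg_eq0.
by rewrite -[c]mulr1 mpolyCM mpolyC1 mul_mpolyC dhomogZ // dhomog1.
Qed.

Lemma der_dhomog0 D p : p \is 0.-homog -> D p = 0.
Proof.
move/dhomog0P => [c ->].
by rewrite -[c]mulr1 mpolyCM mpolyC1 mul_mpolyC derZ der1 scaler0.
Qed.

Lemma dhomog_affine_sub p : (msize p <= 2)%N -> p - (p@_0)%:MP \is 1.-homog.
Proof.
move=> sp; apply/dhomogP => m; rewrite mcoeff_msupp mcoeffB mcoeffC.
case: (eqVneq m 0%MM) => [->|m0]; first by rewrite mulr1 subrr eqxx.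
rewrite mulr0 subr0 -mcoeff_msupp => /msize_mdeg_lt/leq_trans/(_ sp) md.
by apply/eqP; rewrite /= eqn_leq -ltnS md lt0n mdeg_eq0.
Qed.

Lemma euler_monomial (m : 'X_{1..n}) :
  euler K n 'X_[m] = (mdeg m)%:R *: 'X_[m].
Proof.
rewrite derE mdegE natr_sum scaler_suml; apply: eq_bigr => i _.
by rewrite coef_vfield X_mderiv_monomial.
Qed.

Lemma euler_dhomog d p : p \is d.-homog -> euler K n p = d%:R *: p.
Proof.
move=> hp; rewrite [p]mpolyE scaler_sumr big_seq [RHS]big_seq.
rewrite (big_morph (euler K n) (derD _) (der0 _)); apply: eq_bigr => m mp.
rewrite derZ euler_monomial scalerA mulrC -scalerA.
by have /= -> := dhomog_mf hp mp.
Qed.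

Lemma divergence_bracket D E :
  divergence (bracket D E) = D (divergence E) - E (divergence D).
Proof.
(* The double sum is symmetric in F and G, so it cancels in the commutator. *)
have ddiv (F G : Der K n) : \sum_i (F (coef G i))^`M(i) =
    F (divergence G) + \sum_i \sum_j (coef F j)^`M(i) * (coef G i)^`M(j).
  rewrite /divergence (big_morph F (derD _) (der0 _)) -big_split /=.
  apply: eq_bigr => i _; rewrite !derE raddf_sum -big_split /=.
  by apply: eq_bigr => j _; rewrite mderivM addrC mderiv_comm.
rewrite {1}/divergence.
under eq_bigr do rewrite coef_bracket mderivB.
rewrite sumrB !ddiv opprD addrACA [X in _ + X](_ : _ = 0) ?addr0 //.
apply/eqP; rewrite subr_eq0 exchange_big; apply/eqP.
by do 2!apply: eq_bigr => ? _; rewrite mulrC.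
Qed.

Lemma constant_divergence_subalgebra :
  lie_subalgebra (fun D : Der K n => divergence D \is 0.-homog).
Proof.
split=> [|D E hD hE|a D hD|D E hD hE].
- by apply: rpred_sum => i _; rewrite der_coef0 mderiv0 dhomog0.
- rewrite /divergence; under eq_bigr do rewrite der_coefD mderivD.
  by rewrite big_split; apply: rpredD.
- rewrite /divergence; under eq_bigr do rewrite der_coefZ mderivZ.
  by rewrite -scaler_sumr dhomogZ.
- by rewrite divergence_bracket !der_dhomog0 // subr0 dhomog0.
Qed.

Lemma affine_divergence D : W_affine D -> divergence D \is 0.-homog.
Proof.
move=> aD; apply: rpred_sum => i _.
rewrite -[coef D i](subrK ((coef D i)@_0)%:MP) mderivD mderivC addr0.
exact/dhomog_mderiv/dhomog_affine_sub.
Qed.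

(** The infinitesimal projective transformations, written in an affine chart. *)
Definition projective D := exists C L g, [/\ W_homog 0 C, W_homog 1 L,
  g \is 1.-homog & forall i, coef D i = coef C i + coef L i + g * 'X_i].

(** The Euler field is the identity on linear forms, so on them g E_n acts as
    multiplication by g. *)
Lemma projectiveE D C L g :
  (forall i, coef D i = coef C i + coef L i + g * 'X_i) ->
  forall p, p \is 1.-homog -> D p = C p + L p + g * p.
Proof.
move=> eD p hp; rewrite -[in g * p](scale1r p) -(euler_dhomog hp) !derE.
rewrite mulr_sumr -!big_split; apply: eq_bigr => i _.
by rewrite eD !mulrDl coef_vfield mulrA.
Qed.

(** By [projectiveE] the bracket of two projective fields can be computed on
    the variables; the cubic terms cancel since [g E_n, g' E_n] = 0, and the
    quadratic terms combine to (L g' - L' g) E_n. *)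
Lemma projective_subalgebra : lie_subalgebra projective.
Proof.
split=> [|D E|a D|D E].
- exists 0, 0, 0; split=> [i|i||i]; rewrite ?dhomog0 // !der_coef0.
  by rewrite mul0r !addr0.
- move=> [C [L [g [hC hL hg eD]]]] [C' [L' [g' [hC' hL' hg' eE]]]].
  exists (C + C'), (L + L'), (g + g').
  split=> [i|i||i]; rewrite ?der_coefD ?dhomogD //.
  by rewrite eD eE; ring.
- move=> [C [L [g [hC hL hg eD]]]].
  exists (a *: C), (a *: L), (a *: g).
  split=> [i|i||i]; rewrite ?der_coefZ ?dhomogZ //.
  by rewrite eD !scalerDr scalerAl.
move=> [C [L [g [hC hL hg eD]]]] [C' [L' [g' [hC' hL' hg' eE]]]].
exists (bracket C L' + bracket L C').
exists (bracket L L' + vfield (fun i => (C g' - C' g) * 'X_i)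
          + (vfield (fun i => g' * coef C i - g * coef C' i))).
have XH i : ('X_i : A) \is 1.-homog by rewrite dhomogX /= mdeg1.
have DE := projectiveE eD; have EE := projectiveE eE.
exists (L g' - L' g); split=> [i|i||i].
- rewrite der_coefD !coef_bracket.
  rewrite [L' _]der_dhomog0 // [L _]der_dhomog0 // subr0 sub0r.
  by rewrite rpredB ?(dhomog_der (d := 0) (m := 0)).
- rewrite !der_coefD coef_bracket !coef_vfield !rpredD ?rpredB //.
  + exact: (dhomog_der (d := 0) (m := 1)).
  + by rewrite dhomogN; exact: (dhomog_der (d := 0) (m := 1)).
  + apply: (dhomogM (d := 0) (e := 1)) => //.
    by rewrite rpredB ?(dhomog_der (d := 0) (m := 0)).
  + by rewrite mulrC; apply: (dhomogM (d := 0) (e := 1)).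
  + by rewrite dhomogN mulrC; apply: (dhomogM (d := 0) (e := 1)).
- by rewrite rpredB ?(dhomog_der (d := 0) (m := 1)).
rewrite !coef_bracket eD eE !derD !der_leibniz.
rewrite !der_coefD !coef_bracket !coef_vfield.
rewrite [D (coef C' i)]der_dhomog0 // [E (coef C i)]der_dhomog0 //.
rewrite [L (coef C' i)]der_dhomog0 // [L' (coef C i)]der_dhomog0 //.
rewrite !DE ?EE //.
rewrite -/(coef C i) -/(coef C' i) -/(coef L i) -/(coef L' i).
ring.
Qed.

Lemma affine_projective D : W_affine D -> projective D.
Proof.
move=> aD; exists (vfield (fun i => ((coef D i)@_0)%:MP)).
exists (vfield (fun i => coef D i - ((coef D i)@_0)%:MP)), 0.
split=> [i|i||i]; rewrite ?coef_vfield ?dhomog0 //.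
- by apply/dhomog0P; exists (coef D i)@_0.
- exact: dhomog_affine_sub.
- by rewrite mul0r addr0 addrC subrK.
Qed.

End Homogeneous.

Section Necessity.
Variables (K : fieldType) (n : nat).
Hypothesis K0 : [pchar K] =i pred0.
Hypothesis n2 : (2 <= n)%N.
Implicit Types (D E : Der K n).

Lemma not_all_constant_divergence :
  ~ forall E, divergence E \is 0.-homog.
Proof.
pose i0 : 'I_n := Ordinal (ltnW n2) => /(_ (term ('X_i0 * 'X_i0) i0)).
rewrite /divergence (bigD1 i0) // big1 => [|i /negPf i0i]; last first.
  by rewrite coef_term i0i mderiv0.
rewrite coef_term eqxx mderivM mderivXU eqxx mul1r mulr1 [X in X \is _]addr0.
move/dhomog_nemf_coeff => /(_ U_(i0)%MM).
rewrite /= mdeg1 mcoeffD mcoeffXU eqxx.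
by move/(_ isT)/eqP; rewrite -natrD natK_eq0.
Qed.

Lemma not_all_projective : ~ forall E : Der K n, projective E.
Proof.
pose i0 : 'I_n := Ordinal (ltnW n2); pose i1 : 'I_n := Ordinal n2.
move/(_ (term ('X_i0 * 'X_i0) i1)) => [C [L [g [hC hL hg /(_ i1)]]]].
rewrite coef_term eqxx -mpolyXD => /(congr1 (mcoeff (U_(i0) + U_(i0)))).
rewrite !mcoeffD mcoeffX eqxx mcoeffMXU0; last by rewrite mnmDE mnm1E.
rewrite (dhomog_nemf_coeff (hC i1)) ?(dhomog_nemf_coeff (hL i1)) //=;
  rewrite ?mdegD ?mdeg1 //.
by rewrite !addr0 => /eqP; rewrite oner_eq0.
Qed.

Lemma coef_euler i : coef (euler K n) i = 'X_i.
Proof. by rewrite coef_vfield. Qed.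

Lemma euler_factor_homog E f : W_homog 2 E ->
  (forall p, E p = f * euler K n p) -> f \is 1.-homog.
Proof.
move=> hE eE; pose i0 : 'I_n := Ordinal (ltnW n2).
apply/dhomogP => m; rewrite mcoeff_msupp -(mcoeffMX _ U_(i0)) => nz.
have : (U_(i0) + m)%MM \in msupp (coef E i0).
  by rewrite mcoeff_msupp /coef eE -/(coef _ i0) coef_euler.
by move/(dhomog_mf (hE i0)); rewrite /= mdegD mdeg1 => -[].
Qed.

End Necessity.

(** * Homogeneous components and conclusion *)

Section Components.
Variables (K : fieldType) (n k : nat) (D : Der K n) (Dc : nat -> Der K n).
Hypothesis hDc : forall m, (m <= k.+1)%N -> W_homog m (Dc m).
Hypothesis eD : D = \sum_(m < k.+2) Dc m.

Lemma coef_component (m : 'X_{1..n}) j : (mdeg m <= k.+1)%N ->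
  (coef D j)@_m = (coef (Dc (mdeg m)) j)@_m.
Proof.
move=> md; rewrite eD der_coef_sum raddf_sum /=.
rewrite (bigD1 (Ordinal (md : (mdeg m < k.+2)%N))) //= big1 ?addr0 // => i.
rewrite -val_eqE /= => im; apply: dhomog_nemf_coeff (hDc _ j) _.
  by rewrite -ltnS.
by rewrite eq_sym.
Qed.

Lemma top_monomial : Dc k.+1 != 0 ->
  exists j (m : 'X_{1..n}), mdeg m = k.+1 /\ (coef D j)@_m != 0.
Proof.
move=> nz.
have [j jnz | z] := pickP (fun j => coef (Dc k.+1) j != 0); last first.
  by case/eqP: nz; apply: der_eq => j; apply/eqP; move/negbFE: (z j).
have hm := mlead_supp jnz; have /= md := dhomog_mf (hDc (leqnn _) j) hm.
exists j, (mlead (coef (Dc k.+1) j)).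
by rewrite coef_component md // -mcoeff_msupp.
Qed.

End Components.

(* Dc m is the component D_{m-1} of D, for 0 <= m <= k + 1. *)
Theorem theorem2 (K : closedFieldType) (n k : nat) (D : Der K n)
    (Dc : nat -> Der K n) :
  [pchar K] =i pred0 ->
  (2 <= n)%N ->
  (1 <= k)%N ->
  (forall m : nat, (m <= k.+1)%N -> W_homog m (Dc m)) ->
  D = \sum_(m < k.+2) Dc m ->
  Dc k.+1 != 0 ->
  (forall E : Der K n,
     lie_generated (fun F : Der K n => W_affine F \/ F = D) E)
  <->
  ((~ exists c : K, divergence D = c%:MP) /\
   ((2 <= k)%N \/ (k = 1%N /\ ~ proportional_to_euler (Dc 2%N)))).
Proof.
move=> K0 n2 k1 hDc eD nz; split=> [gen | [nc top] E S SL SX].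
- split.
    move/dhomog0P => cD; apply: (not_all_constant_divergence K0 n2) => E.
    apply: (gen E _ (constant_divergence_subalgebra K n)) => F [aF | ->] //.
    exact: affine_divergence.
  case: (ltngtP k 1) k1 => // [|k1] _; [by left | right; split=> // -[f ef]].
  apply: (not_all_projective n2) => E.
  apply: (gen E _ (projective_subalgebra K n)) => F [aF | ->].
    exact: affine_projective.
  rewrite k1 in hDc eD; exists (Dc 0%N), (Dc 1%N), f; split; try exact: hDc.
    exact: euler_factor_homog (hDc 2%N _) ef.
  move=> i; rewrite eD !big_ord_recl big_ord0 addr0 !der_coefD addrA.
  congr (_ + _); rewrite /coef /= ef.
  by rewrite -[euler _ _ _]/(coef (euler K n) i) coef_euler.
have Saff F : W_affine F -> S F by move=> aF; apply: SX; left.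
have SD : S D by apply: SX; right.
apply: (S_all_of_square K0 SL Saff n2 SD _ nc).
case: top => [k2 | [k1' np]].
  have [j [m [md cm]]] := top_monomial hDc eD nz.
  by apply: (square_of_high_degree K0 SL Saff n2 SD cm); rewrite md.
rewrite k1' in hDc eD.
apply: (square_of_quadratic K0 SL Saff n2 SD (hDc 2%N _) _ np) => // m j md.
by rewrite (coef_component hDc eD) md.
Qed.
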